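(* Let $\gamma_1=\gamma_1(\epsilon)$ and $\gamma_2=\gamma_2(\epsilon)$ satisfy $0<\gamma_1<\gamma_2<1$, and let $T_1,T_2,T=T_2\circ T_1$ be the maps (depending on $\epsilon$) defined in the context. Assume that $\gamma_1$ and $\gamma_2$ monotonically tend to zero as $\epsilon\searrow 0$, as well as the quantities $\gamma_1/\gamma_2$ and $\epsilon/\gamma_2$, and additionally assume that $$\lim_{\epsilon\downarrow 0}\frac{\epsilon\gamma_2}{\gamma_1}=0 .$$ Let $(\mathcal{U}_n)_{n\ge0}$ be the sequence defined by $\mathcal{U}_0:=T_2(0)$ and $\mathcal{U}_{n+1}:=T(\mathcal{U}_n)$ for $n\ge0$. Then there exists $\epsilon_0>0$ such that for all $\epsilon$ with $0<\epsilon<\epsilon_0$ there exists $\mathcal{U}^{\ast}$ to which $(\mathcal{U}_n)_n$ converges as $n\to\infty$. Moreover, $\alpha^{\ast}:=T_1(\mathcal{U}^{\ast})>0$.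
   Context: Roughness and micro-domain. $\varphi:\mathbb{R}\to\mathbb{R}$ is a fixed bounded, Lipschitz continuous, $1$-periodic function with $\varphi\ge 0$, $H:=\|\varphi\|_\infty>0$, and $\varphi(N)=H$ for every $N\in\mathbb{Z}$. For small $\epsilon>0$ put $M:=\epsilon H$. The rough boundary (whose maximum height is $x_2=0$) is $\Gamma_\epsilon=\{(x_1,x_2): 0\le x_1\le\epsilon,\ x_2=\epsilon\varphi(x_1/\epsilon)-\epsilon H\}$. For heights $0<\gamma_1<\gamma_2<1$ (which may depend on $\epsilon$) the micro-domain is $\Omega^{\rm mic}=\{(x_1,x_2):0<x_1<\epsilon,\ \epsilon\varphi(x_1/\epsilon)-\epsilon H<x_2<\gamma_2\}$. Let $e_1=(1,0)$. Auxiliary Stokes flows. All flows in $\Omega^{\rm mic}$ are velocity–pressure pairs, $\epsilon$-periodic in $x_1$ (periodic at the side walls $x_1=0$ and $x_1=\epsilon$), solving the homogeneous Stokes system $-\Delta u+\nabla p=0$, $\nabla\cdot u=0$ (weakly). (i) $u_2$ is the solution with $u_2=0$ at $x_2=\gamma_2$ and $u_2=-(x_2+M)(\gamma_2-x_2)\,e_1$ on $\Gamma_\epsilon$. (ii) $\tilde u_3$ is the solution with $\tilde u_3=e_1$ at $x_2=\gamma_2$ and $\tilde u_3=0$ on $\Gamma_\epsilon$. Define the real numbers $\overline{B}_2:=\int_0^\epsilon u_2(x_1,0)\cdot e_1\,dx_1$ and $\tilde B_3:=\int_0^\epsilon\tilde u_3(x_1,0)\cdot e_1\,dx_1$. Maps.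 The macro-to-micro map is $$T_2(\alpha):=-\gamma_2^2+\left(\frac{\gamma_1^2-1-2\gamma_1\alpha}{\gamma_1-1-\alpha}\right)(\gamma_2-1)+1 ,$$ considered for $\alpha\ge0$ and, by the same formula, wherever its denominator is nonzero. The micro-to-macro map is $$T_1(\mathcal{U}):=\frac{C_1+C_2\,\mathcal{U}}{C_3+(1-\tilde B_3)\,\mathcal{U}},\qquad \mathcal{U}\in\mathbb{R},$$ (wherever its denominator is nonzero), with $C_1=\epsilon\gamma_2(\gamma_1+M)(\gamma_2-\gamma_1)+\overline{B}_2(\gamma_2-\gamma_1)$, $C_2=\tilde B_3(\gamma_2-\gamma_1)+\gamma_1$, $C_3=\epsilon\gamma_2(\gamma_2-2\gamma_1-M)-\overline{B}_2$. Finally $T(\mathcal{U}):=T_2(T_1(\mathcal{U}))$. All these objects depend on $\epsilon$. *)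

(* Defs.v *)
From HB Require Import structures.
From mathcomp Require Import all_boot all_order all_algebra.
From mathcomp Require Import all_classical all_reals all_analysis.
Set Implicit Arguments.
Unset Strict Implicit.
Unset Printing Implicit Defensive.
Import Order.TTheory GRing.Theory Num.Theory.
Import numFieldNormedType.Exports.
Local Open Scope classical_set_scope.
Local Open Scope ring_scope.

(* A point of the plane is [x = (x.1, x.2)]; the components of a vector field
   are indexed by ['I_2], so that index [ord0] is the [e_1] direction. *)

Definition lebesgue2 (R : realType) :
    {measure set (measurableTypeR R * measurableTypeR R) -> \bar R} :=
  (@lebesgue_measure R \x @lebesgue_measure R)%E.
Arguments lebesgue2 : clear implicits.

Definition unit_vector (R : realType) (j : 'I_2) : R * R :=
  ((j == ord0)%:R, (j != ord0)%:R).
Arguments unit_vector : clear implicits.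

Definition partial (R : realType) (j : 'I_2) (w : R * R -> R) : R * R -> R :=
  'D_(unit_vector R j) w.

Definition C1 (R : realType) (w : R * R -> R) :=
  forall j : 'I_2, (forall x, derivable w x (unit_vector R j)) /\
                   continuous (partial j w).

Definition square_integrable (d : measure_display) (T : measurableType d)
    (R : realType) (mu : {measure set T -> \bar R}) (A : set T) (f : T -> R) :=
  measurable_fun A f /\ (\int[mu]_(x in A) ((f x) ^+ 2)%:E < +oo)%E.

Definition L2_cvg (d : measure_display) (T : measurableType d)
    (R : realType) (mu : {measure set T -> \bar R}) (A : set T)
    (w : nat -> T -> R) (f : T -> R) :=
  (\int[mu]_(x in A) ((w k x - f x) ^+ 2)%:E)%E @[k --> \oo] --> 0%E.

Definition periodic_x1 (R : realType) (eps : R) (w : R * R -> R) :=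
  forall x1 x2, w (x1 + eps, x2) = w (x1, x2).

(* The part, over one period, of the strip between the graph of [h] and the
   line x_2 = g. *)
Definition cell (R : realType) (eps : R) (h : R -> R) (g : R) : set (R * R) :=
  [set x | 0 < x.1 < eps /\ h x.1 < x.2 < g].

(* The space H^1 of functions that are eps-periodic in x_1 is the closure, in
   the H^1(Om) norm, of the C^1 functions on the plane that are eps-periodic in
   x_1 (Om is one period cell of a strip with Lipschitz boundary). [Df] is the
   weak gradient of [f]. *)
Definition H1per_approx (R : realType) (eps : R) (Om : set (R * R))
    (w : nat -> R * R -> R) (f : R * R -> R) (Df : 'I_2 -> R * R -> R) :=
  [/\ forall k, C1 (w k) /\ periodic_x1 eps (w k),
      L2_cvg (lebesgue2 R) Om w f &
      forall j, L2_cvg (lebesgue2 R) Om (fun k => partial j (w k)) (Df j)].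

Definition H1per (R : realType) (eps : R) (Om : set (R * R))
    (f : R * R -> R) (Df : 'I_2 -> R * R -> R) :=
  [/\ square_integrable (lebesgue2 R) Om f,
      forall j, square_integrable (lebesgue2 R) Om (Df j) &
      exists w, H1per_approx eps Om w f Df].

(* [t x1] is the trace of [f] at the point (x1, s x1) of the graph of [s]: the
   trace operator is the H^1-continuous extension of w |-> w(., s .) from C^1
   functions, hence is computed as a limit along approximating sequences. *)
Definition has_trace (R : realType) (eps : R) (Om : set (R * R))
    (f : R * R -> R) (Df : 'I_2 -> R * R -> R) (s t : R -> R) :=
  [/\ H1per eps Om f Df,
      square_integrable (@lebesgue_measure R) `]0, eps[ t &
      forall w, H1per_approx eps Om w f Df ->
        L2_cvg (@lebesgue_measure R) `]0, eps[
          (fun k x1 => w k (x1, s x1)) t].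

(* Weak solution [(u, p)], with [Du i j] the weak derivative of the i-th
   component [u i] in the direction j, of the homogeneous Stokes system
     - Laplacian u + grad p = 0,   div u = 0
   in [cell eps h g], eps-periodic in x_1, equal to [top] at x_2 = g and to
   [bot] on the graph of [h]. The periodicity of the stress at the side walls
   is enforced by the test functions, which need not vanish there. *)
Record stokes_solution (R : realType) (eps : R) (h : R -> R) (g : R)
    (top bot : 'I_2 -> R -> R) (u : 'I_2 -> R * R -> R)
    (Du : 'I_2 -> 'I_2 -> R * R -> R) (p : R * R -> R) : Prop := {
  stokes_top : forall i,
    has_trace eps (cell eps h g) (u i) (Du i) (fun=> g) (top i);
  stokes_bot : forall i,
    has_trace eps (cell eps h g) (u i) (Du i) h (bot i);
  stokes_pressure : square_integrable (lebesgue2 R) (cell eps h g) p;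
  stokes_div : {ae lebesgue2 R, forall x,
    cell eps h g x -> \sum_(i < 2) Du i i x = 0};
  stokes_momentum : forall (v : 'I_2 -> R * R -> R)
      (Dv : 'I_2 -> 'I_2 -> R * R -> R),
    (forall i, has_trace eps (cell eps h g) (v i) (Dv i) (fun=> g) (fun=> 0)) ->
    (forall i, has_trace eps (cell eps h g) (v i) (Dv i) h (fun=> 0)) ->
    \int[lebesgue2 R]_(x in cell eps h g)
      (\sum_(i < 2) \sum_(j < 2) Du i j x * Dv i j x
       - p x * \sum_(i < 2) Dv i i x) = 0 }.

(* [b] is the integral over 0 < x_1 < eps of the first velocity component on
   the line x_2 = 0, for the flow with data [top] and [bot]. This line may meet
   the graph of [h], so the value of the velocity on it is taken as a trace. *)
Definition line_flux (R : realType) (eps : R) (h : R -> R) (g : R)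
    (top bot : 'I_2 -> R -> R) (b : R) :=
  exists u Du p t,
    [/\ stokes_solution eps h g top bot u Du p,
        has_trace eps (cell eps h g) (u ord0) (Du ord0) (fun=> 0) t &
        b = \int[@lebesgue_measure R]_(x1 in `]0, eps[) t x1].

Definition sup_norm (R : realType) (phi : R -> R) : R :=
  sup (range (fun x => `|phi x|)).

Definition rough (R : realType) (phi : R -> R) (eps x1 : R) : R :=
  eps * phi (x1 / eps) - eps * sup_norm phi.

Definition e1_field (R : realType) (a : R -> R) (i : 'I_2) (x1 : R) : R :=
  if i == ord0 then a x1 else 0.

Definition is_B2 (R : realType) (phi : R -> R) (eps g2 b : R) :=
  line_flux eps (rough phi eps) g2 (fun _ _ => 0)
    (e1_field (fun x1 =>
       - (rough phi eps x1 + eps * sup_norm phi) * (g2 - rough phi eps x1))) b.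

Definition is_B3 (R : realType) (phi : R -> R) (eps g2 b : R) :=
  line_flux eps (rough phi eps) g2 (e1_field (fun=> 1)) (fun _ _ => 0) b.

(* Division is total, with value 0 for a zero denominator, so the domains of
   the two maps are recorded as [T2_dom] and [T1_dom]. *)
Section Maps.
Variable R : realType.

Definition T2_dom (g1 a : R) := g1 - 1 - a != 0.

Definition T2 (g1 g2 a : R) : R :=
  - g2 ^+ 2 + (g1 ^+ 2 - 1 - 2 * g1 * a) / (g1 - 1 - a) * (g2 - 1) + 1.

Definition C_1 (eps M g1 g2 B2 : R) : R :=
  eps * g2 * (g1 + M) * (g2 - g1) + B2 * (g2 - g1).
Definition C_2 (g1 g2 B3 : R) : R := B3 * (g2 - g1) + g1.
Definition C_3 (eps M g1 g2 B2 : R) : R :=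
  eps * g2 * (g2 - 2 * g1 - M) - B2.

Definition T1_dom (eps M g1 g2 B2 B3 U : R) :=
  C_3 eps M g1 g2 B2 + (1 - B3) * U != 0.

Definition T1 (eps M g1 g2 B2 B3 U : R) : R :=
  (C_1 eps M g1 g2 B2 + C_2 g1 g2 B3 * U) /
  (C_3 eps M g1 g2 B2 + (1 - B3) * U).

Definition T (eps M g1 g2 B2 B3 U : R) : R :=
  T2 g1 g2 (T1 eps M g1 g2 B2 B3 U).

Definition U_seq (eps M g1 g2 B2 B3 : R) (n : nat) : R :=
  iter n (T eps M g1 g2 B2 B3) (T2 g1 g2 0).

End Maps.

Definition monotone_to_0 (R : realType) (e1 : R) (f : R -> R) :=
  {in `]0, e1[ &, {homo f : x y / x <= y}} /\ f e @[e --> 0^'+] --> 0.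

(* Main.v *)
Require Import Defs.
From HB Require Import structures.
From mathcomp Require Import all_boot all_order all_algebra.
From mathcomp Require Import all_classical all_reals all_analysis.
From mathcomp Require Import measurable_realfun ring lra.
Set Implicit Arguments.
Unset Strict Implicit.
Unset Printing Implicit Defensive.
Import Order.TTheory GRing.Theory Num.Theory.
Import numFieldNormedType.Exports.
Local Open Scope classical_set_scope.
Local Open Scope ring_scope.

(** The maps depend on the two Stokes flows only through the numbers [B2] and
    [B3], and crude energy bounds on these are enough: as soon as
    [eps * sup_norm phi <= g2],
      [`|B2| <= 4 * eps * g2 ^+ 2]  and  [`|B3| <= 5 * eps].

    Both bounds follow from one estimate, [shear_flux_bound]. The boundary
    values of each flow are those of a shear flow [w = a(x_2) e_1]: for the
    first, [a s = - (s + M) * (g2 - s)]; for the second, [a s] is the square of the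
    positive part of [s / g2], which vanishes on the rough wall because the wall
    does not rise above the line [x_2 = 0]. A shear flow is divergence free, so
    [u - w] is an admissible test field for which the pressure term drops out,
    and the weak formulation says that [grad u] is orthogonal to [grad (u - w)].
    If [`|a'| <= K] on the cell, this bounds the integral of
    [`|d u_1 / d x_2|] over the cell by [K] times the area of the cell. The flux
    through the line [x_2 = 0] differs from the flux [eps * a g2] through the
    top by the integral of [d u_1 / d x_2] over the rectangle in between
    ([trace_difference]), hence by at most that amount.

    With these bounds the iteration is elementary ([U_seq_cvg_positive]). On the
    half line [U >= T2 0 = (g2 - g1) * (1 - g2)] the denominator of [T1] is at
    least [g2 / 4]. Its numerator is positive, because the term [C_2 * U] is of
    size [g1 * g2], whereas the negative part of [C_1] is at most
    [4 * eps * g2 ^+ 3], which is smaller since [eps * g2 / g1] tends to 0. So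
    [T1 > 0] there. As [T2] is increasing and nonexpansive on [alpha >= 0],
    [T] maps the half line to itself; and since the determinant of the Moebius
    map [T1] is of size [eps * g2 ^+ 2], [T] is a contraction for small [eps].
    By Banach's theorem the sequence converges to a limit in the same closed
    half line, where [T1] is positive. *)

(** * Square integrable functions and convergence in mean square *)

Lemma norm_le_young (R : realType) (dl z : R) : 0 < dl ->
  `|z| <= dl / 2 + (2 * dl)^-1 * z ^+ 2.
Proof.
move=> dl0.
have -> : dl / 2 + (2 * dl)^-1 * z ^+ 2 = (dl ^+ 2 + z ^+ 2) / (2 * dl).
  by field; rewrite gt_eqF.
rewrite ler_pdivlMr; last lra.
rewrite -[z ^+ 2]real_normK ?num_real//.
by have := sqr_ge0 (dl - `|z|); lra.
Qed.

Section SquareIntegrable.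
Context d (T : measurableType d) (R : realType).
Variables (mu : {measure set T -> \bar R}) (A : set T).
Hypothesis mA : measurable A.

Lemma square_integrableP (f : T -> R) :
  square_integrable mu A f <->
  measurable_fun A f /\ mu.-integrable A (EFin \o (fun x => f x ^+ 2)).
Proof.
have abs_sq : (\int[mu]_(x in A) `|(f x ^+ 2)%:E| =
               \int[mu]_(x in A) (f x ^+ 2)%:E)%E.
  by apply: eq_integral => x _; rewrite gee0_abs// lee_fin sqr_ge0.
split=> -[mf If]; split=> //.
  apply/integrableP; split; last by rewrite /= abs_sq.
  by apply/measurable_EFinP; exact: measurable_funX.
by case/integrableP : If => _; rewrite /= abs_sq.
Qed.

Lemma square_integrable_mul (f g : T -> R) :
  square_integrable mu A f -> square_integrable mu A g ->
  mu.-integrable A (EFin \o (fun x => f x * g x)).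
Proof.
move=> /square_integrableP[mf If] /square_integrableP[mg Ig].
apply: le_integrable (integrableD mA If Ig) => //.
  by apply/measurable_EFinP; exact: measurable_funM.
move=> x _; rewrite -EFinD /= lee_fin [leRHS]ger0_norm ?addr_ge0 ?sqr_ge0//.
have := sqr_ge0 (f x - g x); have := sqr_ge0 (f x + g x).
by rewrite ler_norml => *; apply/andP; split; lra.
Qed.

Lemma square_integrableD (f g : T -> R) :
  square_integrable mu A f -> square_integrable mu A g ->
  square_integrable mu A (fun x => f x + g x).
Proof.
move=> sf sg; apply/square_integrableP; split.
  by apply: measurable_funD; [case: sf|case: sg].
have -> : EFin \o (fun x => (f x + g x) ^+ 2) =
    (EFin \o (fun x => f x * f x)) \+ (EFin \o (fun x => f x * g x)) \+
    ((EFin \o (fun x => f x * g x)) \+ (EFin \o (fun x => g x * g x))).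
  by apply/funext => x /=; rewrite -!EFinD; congr EFin; ring.
by apply: integrableD => //; apply: integrableD => //;
  exact: square_integrable_mul.
Qed.

Lemma square_integrableZ (c : R) (f : T -> R) :
  square_integrable mu A f -> square_integrable mu A (fun x => c * f x).
Proof.
move=> /square_integrableP[mf If]; apply/square_integrableP; split.
  by apply: measurable_funM => //; exact: measurable_cst.
have := integrableZl mA (c ^+ 2) If; apply: eq_integrable => // x _ /=.
by rewrite exprMn EFinM.
Qed.

Lemma square_integrableB (f g : T -> R) :
  square_integrable mu A f -> square_integrable mu A g ->
  square_integrable mu A (fun x => f x - g x).
Proof.
move=> sf sg; have := square_integrableD sf (square_integrableZ (-1) sg).
by under [X in square_integrable _ _ X -> _]eq_fun do rewrite mulN1r.
Qed.

Lemma square_integrable_bounded (f : T -> R) (K : R) : (mu A < +oo)%E ->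
  measurable_fun A f -> (forall x, A x -> `|f x| <= K) ->
  square_integrable mu A f.
Proof.
move=> Afin mf fK; apply/square_integrableP; split => //.
apply: measurable_bounded_integrable => //; first exact: measurable_funX.
exists (K ^+ 2); split; first exact: num_real.
move=> c Kc x Ax /=; rewrite (le_trans _ (ltW Kc))// ger0_norm ?sqr_ge0//.
rewrite -real_normK ?num_real// lerXn2r ?nnegrE//; last exact: fK.
by rewrite (le_trans _ (fK _ Ax)).
Qed.

Lemma square_integrable_integrable (f : T -> R) : (mu A < +oo)%E ->
  square_integrable mu A f -> mu.-integrable A (EFin \o f).
Proof.
move=> Afin sf; have s1 : square_integrable mu A (cst (1 : R)).
  by apply: (@square_integrable_bounded _ 1) => // x _; rewrite normr1.
have := square_integrable_mul sf s1.
by apply: eq_integrable => // x _ /=; rewrite mulr1.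
Qed.

Lemma L2_cvg_square_integrable (w : nat -> T -> R) (f : T -> R) :
  (forall k, measurable_fun A (w k)) -> square_integrable mu A f ->
  L2_cvg mu A w f -> \forall k \near \oo, square_integrable mu A (w k).
Proof.
move=> mw sf wf; have : \forall k \near \oo,
    (\int[mu]_(x in A) ((w k x - f x) ^+ 2)%:E < 1)%E.
  move: wf; rewrite /L2_cvg => /(_ [set y | (y < 1)%E]); apply.
  apply: open_nbhs_nbhs; split; first exact: open_ereal_lt_ereal.
  by rewrite /= lte01.
apply: filterS => k wk.
have -> : w k = fun x => (w k x - f x) + f x.
  by apply/funext => x; rewrite subrK.
apply: square_integrableD => //; split; last by rewrite (lt_le_trans wk)// leey.
by apply: measurable_funB => //; case: sf.
Qed.

(** By [norm_le_young] the integral of [`|w k - f|] is at most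
    [dl / 2 * mu A] plus the mean square distance divided by [2 * dl], for every
    [dl > 0]. *)
Lemma L2_cvg_Rintegral (w : nat -> T -> R) (f : T -> R) : (mu A < +oo)%E ->
  (forall k, measurable_fun A (w k)) -> square_integrable mu A f ->
  L2_cvg mu A w f ->
  (\int[mu]_(x in A) w k x)%R @[k --> \oo] --> (\int[mu]_(x in A) f x)%R.
Proof.
move=> Afin mw sf wf; apply/cvgrPdist_le => e e0.
set m := fine (mu A); have m0 : 0 <= m by rewrite fine_ge0.
(* the summand 1 covers the case of a null set *)
pose dl := e / (m + 1); have dl0 : 0 < dl by rewrite divr_gt0// ltr_wpDl.
have := L2_cvg_square_integrable mw sf wf; apply: filter_app.
have : \forall k \near \oo,
    (\int[mu]_(x in A) ((w k x - f x) ^+ 2)%:E < (dl * e)%:E)%E.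
  move: wf; rewrite /L2_cvg => /(_ [set y | (y < (dl * e)%R%:E)%E]); apply.
  apply: open_nbhs_nbhs; split; first exact: open_ereal_lt_ereal.
  by rewrite /= lte_fin mulr_gt0.
apply: filterS => k Nk sw; have sd := square_integrableB sw sf.
have [iw jf] := (square_integrable_integrable Afin sw,
                 square_integrable_integrable Afin sf).
have id := square_integrable_integrable Afin sd.
have [_ id2] := (square_integrableP _).1 sd.
have ic : mu.-integrable A (EFin \o cst (dl / 2)).
  apply: square_integrable_integrable => //.
  by apply: (@square_integrable_bounded _ `|dl / 2|).
rewrite distrC -RintegralB// (le_trans (le_normr_Rintegral mA id))//.
have iq : mu.-integrable A
    (EFin \o (fun x => (2 * dl)^-1 * (w k x - f x) ^+ 2)).
  by have := integrableZl mA (2 * dl)^-1 id2; apply: eq_integrable.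
apply: le_trans (_ : _ <= \int[mu]_(x in A)
   (dl / 2 + (2 * dl)^-1 * (w k x - f x) ^+ 2)) _.
  apply: le_Rintegral => //.
  - by have := integrable_abse id; apply: eq_integrable.
  - by have := integrableD mA ic iq; apply: eq_integrable.
  - by move=> x Ax; exact: norm_le_young.
rewrite RintegralD// Rintegral_cst// RintegralZl// -/m.
have N_le : \int[mu]_(x in A) (w k x - f x) ^+ 2 <= dl * e.
  rewrite -lee_fin /Rintegral fineK ?ltW//.
  by apply: integrable_fin_num.
have {N_le} : (2 * dl)^-1 * (\int[mu]_(x in A) (w k x - f x) ^+ 2) <= e / 2.
  have -> : e / 2 = (2 * dl)^-1 * (dl * e) by field; rewrite gt_eqF.
  by rewrite ler_wpM2l// invr_ge0 mulr_ge0// ltW.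
have : e = dl * m + dl.
  by rewrite -[X in _ + X]mulr1 -mulrDr divfK// gt_eqF// ltr_wpDl.
move: (_^-1 * _) => N; clear -dl0; lra.
Qed.

End SquareIntegrable.

(** * Calculus and Fubini's theorem in the plane *)

Section PlaneMeasurability.
Variable R : realType.

(** An open set is the union of the boxes with rational corners inside it, and
    there are countably many of these. *)
Lemma open_plane_measurable (O : set (R * R)) : open O ->
  measurable (O : set (measurableTypeR R * measurableTypeR R)).
Proof.
move=> oO.
pose box (q : (rat * rat) * (rat * rat)) : set (R * R) :=
  `]ratr q.1.1, ratr q.1.2[ `*` `]ratr q.2.1, ratr q.2.2[.
pose F q : set (R * R) := if pselect (box q `<=` O) then box q else set0.
have -> : O = \bigcup_q F q.
  apply/seteqP; split => [x Ox|x [q _]]; last first.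
    by rewrite /F; case: pselect => //= h /h.
  have /nbhs_ballP[e /= e0 xe] := open_nbhs_nbhs (conj oO Ox).
  have near_rat (y : R) : exists q : rat * rat,
      ratr q.1 < y < ratr q.2 /\ y - e < ratr q.1 /\ ratr q.2 < y + e.
    have [q1] := @rat_in_itvoo R (y - e) y ltac:(by rewrite ltrBlDr ltrDl).
    have [q2] := @rat_in_itvoo R y (y + e) ltac:(by rewrite ltrDl).
    rewrite !in_itv /= => /andP[a b] /andP[c d].
    by exists (q1, q2) => /=; rewrite b d.
  have [p [/andP[p1 p2] [p3 p4]]] := near_rat x.1.
  have [q [/andP[q1 q2] [q3 q4]]] := near_rat x.2.
  have bO : box (p, q) `<=` O.
    move=> z [/=]; rewrite !in_itv /= => /andP[z1 z2] /andP[z3 z4].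
    by apply: xe; split; rewrite /ball /= ltr_norml; apply/andP; split; lra.
  exists (p, q) => //; rewrite /F; case: pselect => //= _.
  by split => /=; rewrite in_itv /= ?p1 ?p2 ?q1 ?q2.
apply: countable_bigcupT_measurable => [|q]; first exact: countableP.
rewrite /F.
by case: pselect => //= _; apply: measurableX; exact: measurable_itv.
Qed.

Lemma continuous_plane_measurable (f : R * R -> R) : continuous f ->
  measurable_fun setT (f : measurableTypeR R * measurableTypeR R -> R).
Proof.
move=> /continuousP cf; apply: (measurability _ (RGenOpens.measurableE R)).
move=> _ [_ [a [b ->] <-]]; rewrite setTI.
by apply: open_plane_measurable; apply: cf; exact: interval_open.
Qed.

End PlaneMeasurability.

Section Slices.
Variable R : realType.
Implicit Types (w : R * R -> R) (a s : R) (x : R * R).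

Lemma slice1_eq w a s :
  (fun h => h^-1 *: ((w \o shift (a, s)) (h *: unit_vector R ord0)
                     - w (a, s))) =
  (fun h => h^-1 *: (((fun r => w (r, s)) \o shift a) (h *: (1 : R))
                     - w (a, s))).
Proof.
apply/funext => h; rewrite /= /shift /=; congr (_ *: (w (_, _) - _)).
by rewrite -[RHS]add0r; congr (_ + _); exact: mulr0.
Qed.

Lemma slice2_eq w a s :
  (fun h => h^-1 *: ((w \o shift (a, s)) (h *: unit_vector R ord_max)
                     - w (a, s))) =
  (fun h => h^-1 *: (((fun r => w (a, r)) \o shift s) (h *: (1 : R))
                     - w (a, s))).
Proof.
apply/funext => h; rewrite /= /shift /=; congr (_ *: (w (_, _) - _)).
by rewrite -[RHS]add0r; congr (_ + _); exact: mulr0.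
Qed.

Lemma slice1_derivable w a s : derivable w (a, s) (unit_vector R ord0) ->
  derivable (fun r => w (r, s)) a 1.
Proof. by rewrite /derivable slice1_eq. Qed.

Lemma slice2_derivable w a s : derivable w (a, s) (unit_vector R ord_max) ->
  derivable (fun r => w (a, r)) s 1.
Proof. by rewrite /derivable slice2_eq. Qed.

Lemma slice2_derive w a s :
  derive1 (fun r => w (a, r)) s = partial ord_max w (a, s).
Proof. by rewrite derive1E /partial /derive slice2_eq. Qed.

Lemma C1_slice1_measurable w s :
  C1 w -> measurable_fun setT (fun r => w (r, s)).
Proof.
move=> Cw; apply: continuous_measurable_fun => r.
apply/differentiable_continuous/derivable1_diffP/slice1_derivable.
by case: (Cw ord0).
Qed.

Lemma C1_partial_measurable w j : C1 w ->
  measurable_fun setT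
    (partial j w : measurableTypeR R * measurableTypeR R -> R).
Proof. by move=> /(_ j)[_ cw]; exact: continuous_plane_measurable. Qed.

Lemma C1_slice2_FTC w a (s1 s2 : R) : s1 < s2 -> C1 w ->
  (\int[lebesgue_measure]_(r in `]s1, s2[) (partial ord_max w (a, r))%:E =
   (w (a, s2) - w (a, s1))%:E)%E.
Proof.
move=> s12 /(_ ord_max)[dw cw].
have cp : continuous (fun r => partial ord_max w (a, r)).
  move=> r; apply: (@continuous_comp _ _ _ (pair a)); last exact: cw.
  apply: (@cvg_pair _ _ _ _ (nbhs a) (nbhs r)); first exact: cvg_cst.
  exact: cvg_id.
have cw2 : continuous (fun r => w (a, r)).
  move=> r; apply/differentiable_continuous/derivable1_diffP.
  exact: slice2_derivable.
rewrite EFinB.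
have <- : (\int[lebesgue_measure]_(r in `[s1, s2]) (partial ord_max w (a, r))%:E
    = (w (a, s2))%:E - (w (a, s1))%:E)%E.
  apply: (@continuous_FTC2 _ _ (fun r => w (a, r))) => //.
  - exact: continuous_subspaceT.
  - split=> [r _||]; first exact: slice2_derivable.
    + by apply: cvg_at_right_filter; exact: cw2.
    + by apply: cvg_at_left_filter; exact: cw2.
  - by move=> r _; exact: slice2_derive.
have mp : measurable_fun `]s1, s2[
    (EFin \o (fun r => partial ord_max w (a, r))).
  apply/measurable_EFinP; apply: measurable_funTS.
  exact: continuous_measurable_fun.
exact: esym (integral_itv_bndoo true false mp).
Qed.

Lemma Rintegral_rectangle (A B : set R) (f : R * R -> R) :
  measurable A -> measurable B ->
  (lebesgue2 R).-integrable (A `*` B) (EFin \o f) ->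
  \int[lebesgue2 R]_(x in A `*` B) f x =
  fine (\int[lebesgue_measure]_(x in A)
          \int[lebesgue_measure]_(y in B) (f (x, y))%:E)%E.
Proof.
move=> mA mB If; rewrite /Rintegral; congr fine.
have mAB : measurable (A `*` B : set (measurableTypeR R * measurableTypeR R)).
  exact: measurableX.
rewrite integral_mkcond -[LHS]integral12_prod_meas1; last first.
  exact: (integrable_mkcond _ mAB).1 If.
rewrite [RHS]integral_mkcond; apply: eq_integral => x _.
rewrite /fubini_F patchE; case: ifPn => xA.
  rewrite [RHS]integral_mkcond; apply: eq_integral => y _.
  by rewrite !patchE in_setX /= xA.
by apply: integral0_eq => y _; rewrite patchE in_setX /= (negbTE xA).
Qed.

Lemma C1_rectangle_flux w (b s1 s2 : R) : 0 < b -> s1 < s2 -> C1 w ->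
  (lebesgue2 R).-integrable (`]0, b[ `*` `]s1, s2[)
    (EFin \o partial ord_max w) ->
  \int[lebesgue2 R]_(x in `]0, b[ `*` `]s1, s2[) partial ord_max w x =
  \int[lebesgue_measure]_(x in `]0, b[) (w (x, s2) - w (x, s1)).
Proof.
move=> b0 s12 Cw Iw; rewrite Rintegral_rectangle//.
congr fine; apply: eq_integral => x _; exact: C1_slice2_FTC.
Qed.

End Slices.

(** * Traces on horizontal lines and on graphs *)

Section Traces.
Variable R : realType.
Implicit Types (eps : R) (Om : set (R * R)) (f w v : R * R -> R).
Local Notation plane := (measurableTypeR R * measurableTypeR R)%type.

Lemma L2_cvg_subset d (T : measurableType d) (mu : {measure set T -> \bar R})
    (A B : set T) (w : nat -> T -> R) (f : T -> R) :
  measurable A -> measurable B -> B `<=` A ->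
  (forall k, measurable_fun A (w k)) -> measurable_fun A f ->
  L2_cvg mu A w f -> L2_cvg mu B w f.
Proof.
move=> mA mB BA mw mf.
apply: squeeze_cvge (@cvg_cst _ _ _ _ _); apply: nearW => k.
apply/andP; split; first by apply: integral_ge0 => x _; rewrite lee_fin sqr_ge0.
apply: ge0_subset_integral => //.
  by apply/measurable_EFinP; apply: measurable_funX; exact: measurable_funB.
by move=> x _; rewrite lee_fin sqr_ge0.
Qed.

Lemma eq_L2_cvg d (T : measurableType d) (mu : {measure set T -> \bar R})
    (A : set T) (w z : nat -> T -> R) (f g : T -> R) :
  (forall k x, w k x - f x = z k x - g x) ->
  L2_cvg mu A w f -> L2_cvg mu A z g.
Proof.
move=> wz; rewrite /L2_cvg.
suff -> : (fun k => \int[mu]_(x in A) ((w k x - f x) ^+ 2)%:E)%E =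
          (fun k => \int[mu]_(x in A) ((z k x - g x) ^+ 2)%:E)%E by [].
by apply/funext => k; apply: eq_integral => x _; rewrite wz.
Qed.

Lemma square_integrableS d (T : measurableType d)
    (mu : {measure set T -> \bar R}) (A B : set T) (f : T -> R) :
  measurable A -> measurable B -> B `<=` A ->
  square_integrable mu A f -> square_integrable mu B f.
Proof.
move=> mA mB BA [mf If]; split; first exact: measurable_funS mf.
apply: le_lt_trans If; apply: ge0_subset_integral => //.
  by apply/measurable_EFinP; exact: measurable_funX.
by move=> x _; rewrite lee_fin sqr_ge0.
Qed.

Lemma lebesgue2_rectangle (a b c e : R) : a < b -> c < e ->
  lebesgue2 R (`]a, b[ `*` `]c, e[) = ((b - a) * (e - c))%:E.
Proof.
move=> ab ce; rewrite EFinM.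
have len (u v : R) : u < v -> (v - u)%:E = lebesgue_measure (`]u, v[ : set R).
  by move=> uv; rewrite lebesgue_measure_itv /= lte_fin uv EFinB.
rewrite (len _ _ ab) (len _ _ ce); exact: product_measure1E.
Qed.

Lemma lebesgue_measure_itv_lty (a b : R) :
  (lebesgue_measure (`]a, b[%classic : set R) < +oo)%E.
Proof.
rewrite lebesgue_measure_itv /=; case: ifP => _ //.
by rewrite -EFinB ltry.
Qed.

(** For C^1 functions this is the fundamental theorem of calculus integrated
    over the rectangle. It passes to the limit because both traces and the weak
    derivative are mean square limits along one and the same approximating
    sequence. *)
Lemma trace_difference eps Om f (Df : 'I_2 -> R * R -> R) (s1 s2 : R)
    (t1 t2 : R -> R) :
  0 < eps -> s1 < s2 -> measurable (Om : set plane) ->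
  `]0, eps[ `*` `]s1, s2[ `<=` Om ->
  has_trace eps Om f Df (fun=> s1) t1 -> has_trace eps Om f Df (fun=> s2) t2 ->
  \int[lebesgue2 R]_(x in `]0, eps[ `*` `]s1, s2[) Df ord_max x =
  \int[lebesgue_measure]_(x in `]0, eps[) t2 x -
  \int[lebesgue_measure]_(x in `]0, eps[) t1 x.
Proof.
move=> eps0 s12 mOm sub.
move=> [[sf sDf [w aw]] st1 /(_ w aw) wt1] [_ st2 /(_ w aw) wt2].
set Q := `]0, eps[ `*` `]s1, s2[; have mQ : measurable (Q : set plane).
  exact: measurableX.
have [Cw _ /(_ ord_max) wD] := aw.
have mp k (A : set plane) : measurable_fun A (partial ord_max (w k)).
  by apply: measurable_funTS; apply: C1_partial_measurable; case: (Cw k).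
have ms k s : measurable_fun `]0, eps[ (fun r => w k (r, s)).
  by apply: measurable_funTS; apply: C1_slice1_measurable; case: (Cw k).
have sDQ : square_integrable (lebesgue2 R) Q (Df ord_max).
  exact: square_integrableS (sDf _).
have wDQ : L2_cvg (lebesgue2 R) Q (fun k => partial ord_max (w k)) (Df ord_max).
  by apply: L2_cvg_subset wD => //; case: (sDf ord_max).
have Qfin : (lebesgue2 R Q < +oo)%E by rewrite lebesgue2_rectangle// ltry.
pose I : set R := `]0, eps[%classic.
have mI : measurable I by exact: measurable_itv.
have Ifin : (lebesgue_measure I < +oo)%E by exact: lebesgue_measure_itv_lty.
have lim2 := L2_cvg_Rintegral mQ Qfin (fun k => mp k _) sDQ wDQ.
have cvI s t := @L2_cvg_Rintegral _ _ _ lebesgue_measure _ mI _ t Ifin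
  (fun k => ms k s).
have sqI s t := @L2_cvg_square_integrable _ _ _ lebesgue_measure _ mI _ t
  (fun k => ms k s).
have lim1 := cvgB (cvI s2 _ st2 wt2) (cvI s1 _ st1 wt1).
suff lim3 : \int[lebesgue2 R]_(x in Q) partial ord_max (w k) x @[k --> \oo] -->
    \int[lebesgue_measure]_(x in I) t2 x - \int[lebesgue_measure]_(x in I) t1 x.
  exact: (cvg_unique (@Rhausdorff R) lim2 lim3).
have n3 := L2_cvg_square_integrable mQ (fun k => mp k _) sDQ wDQ.
suff E : \forall k \near \oo,
    \int[lebesgue_measure]_(x in I) w k (x, s2) -
    \int[lebesgue_measure]_(x in I) w k (x, s1) =
    \int[lebesgue2 R]_(x in Q) partial ord_max (w k) x.
  exact: cvg_trans (near_eq_cvg E) (lim1 _).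
move: (sqI s1 _ st1 wt1) (sqI s2 _ st2 wt2) n3.
apply: filterS3 => k i1 i2 i3.
rewrite C1_rectangle_flux//; last 2 first.
- by case: (Cw k).
- exact: square_integrable_integrable.
by rewrite RintegralB//; exact: square_integrable_integrable.
Qed.

Lemma C1_add_scale (c : R) w v : C1 w -> C1 v ->
  C1 (fun x => w x + c * v x) /\
  forall j, partial j (fun x => w x + c * v x) =
            (fun x => partial j w x + c * partial j v x).
Proof.
move=> Cw Cv.
have pE j : partial j (fun x => w x + c * v x) =
            (fun x => partial j w x + c * partial j v x).
  apply/funext => x; have [[dw _] [dv _]] := (Cw j, Cv j).
  rewrite /partial (@deriveD _ _ _ w (c \*: v))// ?deriveZ//.
  exact: derivableZ.
split=> // j; have [[dw cw] [dv cv]] := (Cw j, Cv j).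
split=> [x|].
  by apply: (@derivableD _ _ _ w (c \*: v)) => //; exact: derivableZ.
rewrite pE => x; apply: continuousD; first exact: cw.
by apply: continuousM; [exact: cst_continuous|exact: cv].
Qed.

Lemma H1per_approx_add_scale (c : R) eps Om (w : nat -> R * R -> R) f Df v :
  C1 v -> periodic_x1 eps v -> H1per_approx eps Om w f Df ->
  H1per_approx eps Om (fun k x => w k x + c * v x) (fun x => f x + c * v x)
    (fun j x => Df j x + c * partial j v x).
Proof.
move=> Cv pv [Cw wf wD]; split.
- move=> k; have [Cwk pwk] := Cw k.
  split; first by case: (C1_add_scale c Cwk Cv).
  by move=> x1 x2; rewrite pwk pv.
- by apply: eq_L2_cvg wf => k x; ring.
- move=> j; apply: eq_L2_cvg (wD j) => k x.
  by rewrite (C1_add_scale c (Cw k).1 Cv).2; ring.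
Qed.

(** Adding [c * v] to the approximating sequences of [f] gives exactly those of
    [f + c * v]: an arbitrary approximating sequence of the latter is brought
    back by adding [- c * v]. *)
Lemma has_trace_add_scale (c : R) eps Om f Df v (s t : R -> R) :
  measurable (Om : set plane) -> C1 v -> periodic_x1 eps v ->
  square_integrable (lebesgue2 R) Om v ->
  (forall j, square_integrable (lebesgue2 R) Om (partial j v)) ->
  square_integrable lebesgue_measure `]0, eps[ (fun r => v (r, s r)) ->
  has_trace eps Om f Df s t ->
  has_trace eps Om (fun x => f x + c * v x)
    (fun j x => Df j x + c * partial j v x) s (fun r => t r + c * v (r, s r)).
Proof.
move=> mOm Cv pv sv sDv svs [[sf sDf [w aw]] st tr].
split.
- split.
  + by apply: square_integrableD => //; exact: square_integrableZ.
  + by move=> j; apply: square_integrableD => //; exact: square_integrableZ.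
  + by eexists; exact: H1per_approx_add_scale aw.
- by apply: square_integrableD => //; exact: square_integrableZ.
- move=> z /(H1per_approx_add_scale (- c) Cv pv) az.
  have /eq_L2_cvg : L2_cvg lebesgue_measure `]0, eps[
      (fun k r => z k (r, s r) + - c * v (r, s r)) t.
    apply: (tr (fun k x => z k x + - c * v x)); move: az.
    congr H1per_approx; last first.
      by apply/funext => j; apply/funext => x; ring.
    by apply/funext => x; ring.
  by apply => k r; ring.
Qed.

End Traces.

(** * Energy estimate for Stokes flows with shear boundary data *)

Lemma ord2P (j : 'I_2) : j = ord0 \/ j = ord_max.
Proof. by case: j => -[|[|//]] i; [left|right]; apply: val_inj. Qed.

Section Shear.
Variable R : realType.

Lemma shear_C1 (a a' : R -> R) :
  (forall s : R, is_derive s 1 a (a' s)) -> continuous a' ->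
  [/\ C1 (fun x : R * R => a x.2),
      partial ord0 (fun x : R * R => a x.2) = cst 0 &
      partial ord_max (fun x : R * R => a x.2) = (fun x => a' x.2)].
Proof.
move=> da ca'.
pose A := fun x : R * R => a x.2.
have q0 x : (fun h => h^-1 *: ((A \o shift x) (h *: unit_vector R ord0) - A x))
    = cst 0.
  apply/funext => h.
  have e : (h *: unit_vector R ord0 + x).2 = x.2.
    by rewrite -[RHS]add0r; congr (_ + _); exact: mulr0.
  change (h^-1 *: (a (h *: unit_vector R ord0 + x).2 - a x.2) = 0).
  by rewrite e subrr scaler0.
have d0 x : derivable A x (unit_vector R ord0).
  by rewrite /derivable q0; exact: is_cvg_cst.
have d1 x : derivable A x (unit_vector R ord_max).
  exact: (da x.2).(ex_derive).
have p0 : partial ord0 A = cst 0.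
  by apply/funext => x; rewrite /partial /derive q0; exact: lim_cst.
have p1 : partial ord_max A = (fun x => a' x.2).
  by apply/funext => x; exact: (da x.2).(derive_val).
split; [move=> j|exact: p0|exact: p1].
have [->|->] := ord2P j.
- by split=> [x|]; [exact: d0|rewrite p0; exact: cst_continuous].
- split=> [x|]; first exact: d1.
  rewrite p1 => x; apply: (@continuous_comp _ _ _ snd a'); last exact: ca'.
  exact: cvg_snd.
Qed.

Lemma sum_ord2 (F : 'I_2 -> R) : \sum_(i < 2) F i = F ord0 + F ord_max.
Proof.
rewrite !big_ord_recr big_ord0 /= add0r.
by congr (F _ + F _); apply: val_inj.
Qed.

End Shear.

Section Cell.
Variables (R : realType) (eps M g : R) (h : R -> R).
Local Notation plane := (measurableTypeR R * measurableTypeR R)%type.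

Lemma cell_measurable : measurable_fun setT h ->
  measurable (cell eps h g : set plane).
Proof.
move=> mh.
have m1 := @measurable_fst _ _ (measurableTypeR R) (measurableTypeR R).
have m2 := @measurable_snd _ _ (measurableTypeR R) (measurableTypeR R).
have lt_meas (u v : plane -> R) : measurable_fun setT u ->
    measurable_fun setT v -> measurable [set x | u x < v x].
  move=> mu mv; have := measurable_fun_ltr mu mv.
  by move=> /(_ measurableT [set true] ltac:(by [])); rewrite setTI.
have -> : cell eps h g = ([set x | 0 < x.1] `&` [set x | x.1 < eps]) `&`
                         ([set x | h x.1 < x.2] `&` [set x | x.2 < g]).
  by apply/seteqP; split=> x; rewrite /cell /=;
    [move=> [/andP[? ?] /andP[? ?]]|move=> [[-> ->] [-> ->]]].
apply: measurableI; apply: measurableI; apply: lt_meas => //.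
exact: measurableT_comp.
Qed.

Lemma cell_le_rectangle : (forall x, - M <= h x) ->
  cell eps h g `<=` `]0, eps[ `*` `](- M), g[.
Proof.
move=> hM x [x1 /andP[x2 x3]]; split; rewrite /= in_itv //=.
by rewrite x3 (le_lt_trans (hM _) x2).
Qed.

End Cell.

Section StokesFlux.
Variable R : realType.
Local Notation plane := (measurableTypeR R * measurableTypeR R)%type.

Lemma continuous_bounded_itv (a : R -> R) (l r : R) : continuous a -> l <= r ->
  exists L, forall s, l <= s <= r -> `|a s| <= L.
Proof.
move=> ca lr; have cn : continuous (fun s => `|a s|).
  move=> s; apply: (@continuous_comp _ _ _ a); first exact: ca.
  exact: norm_continuous.
have [c _ cmax] := EVT_max lr (continuous_subspaceT cn).
by exists `|a c| => s hs; apply: cmax; rewrite in_itv.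
Qed.

Variables (eps M g K : R) (h : R -> R) (a a' : R -> R).
Hypotheses (eps_gt0 : 0 < eps) (M_ge0 : 0 <= M) (g_gt0 : 0 < g) (K_gt0 : 0 < K).
Hypotheses (mh : measurable_fun setT h) (h_ge : forall x, - M <= h x)
  (h_le0 : forall x, h x <= 0).
Hypotheses (da : forall s : R, is_derive s 1 a (a' s)) (ca' : continuous a')
  (a'K : forall s, - M <= s <= g -> `|a' s| <= K).

Let Om : set plane := cell eps h g.
Let A (x : R * R) := a x.2.

Let mOm : measurable Om. Proof. exact: cell_measurable. Qed.

Let Mg : - M < g.
Proof. by apply: le_lt_trans g_gt0; rewrite oppr_le0. Qed.

Let Om_le : (lebesgue2 R Om <= (eps * (M + g))%:E)%E.
Proof.
have -> : eps * (M + g) = (eps - 0) * (g - - M) by ring.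
rewrite -lebesgue2_rectangle//; apply: le_measure; rewrite ?inE//.
  exact: measurableX.
exact: cell_le_rectangle.
Qed.

Let Om_fin : (lebesgue2 R Om < +oo)%E.
Proof. by apply: le_lt_trans Om_le _; rewrite ltry. Qed.

Let Om_height x : Om x -> - M <= x.2 <= g.
Proof.
move=> [_ /andP[x2 x3]]; rewrite (ltW x3) andbT.
by rewrite (le_trans (h_ge _) (ltW x2)).
Qed.

Let ca : continuous a.
Proof.
move=> s; apply/differentiable_continuous/derivable1_diffP.
exact: (da s).(ex_derive).
Qed.

Let A_sq : square_integrable (lebesgue2 R) Om A.
Proof.
have [L aL] := continuous_bounded_itv ca (ltW Mg).
apply: (@square_integrable_bounded _ _ _ _ _ mOm _ L) => //.
  apply: measurable_funTS; apply: measurableT_comp; last exact: measurable_snd.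
  exact: continuous_measurable_fun.
by move=> x Ox; apply: aL; exact: Om_height.
Qed.

Let A_partial_sq j : square_integrable (lebesgue2 R) Om (partial j A).
Proof.
have [C1A p0 p1] := shear_C1 da ca'.
apply: (@square_integrable_bounded _ _ _ _ _ mOm _ K) => //.
  by apply: measurable_funTS; exact: C1_partial_measurable.
move=> x Ox; have [->|->] := ord2P j.
- by rewrite p0 normr0 ltW.
- by rewrite p1; apply: a'K; exact: Om_height.
Qed.

Let A_trace_sq (s : R -> R) : measurable_fun setT s ->
  (forall x, - M <= s x <= g) ->
  square_integrable lebesgue_measure `]0, eps[ (fun r => A (r, s r)).
Proof.
move=> ms sM; have [L aL] := continuous_bounded_itv ca (ltW Mg).
pose I : set R := `]0, eps[%classic.
have mI : measurable I by exact: measurable_itv.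
have Ifin : (lebesgue_measure I < +oo)%E by exact: lebesgue_measure_itv_lty.
apply: (@square_integrable_bounded _ _ _ lebesgue_measure I mI _ L Ifin).
  apply: measurable_funTS; apply: (measurableT_comp (f := a)) => //.
  exact: continuous_measurable_fun.
by move=> x _; apply: aL; exact: sM.
Qed.

Variables (top bot : 'I_2 -> R -> R) (u : 'I_2 -> R * R -> R).
Variables (Du : 'I_2 -> 'I_2 -> R * R -> R) (p : R * R -> R).
Hypothesis topE : top = e1_field (fun=> a g).
Hypothesis botE : bot = e1_field (a \o h).
Hypothesis us : stokes_solution eps h g top bot u Du p.

(** The test field [u - a(x_2) e_1]; the coefficient [c i] is [-1] for the first
    component and [0] for the second, so that one formula serves for both. *)
Let c (i : 'I_2) : R := - (i == ord0)%:R.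
Let v i (x : R * R) := u i x + c i * A x.
Let Dv i j (x : R * R) := Du i j x + c i * partial j A x.

Let A_periodic : periodic_x1 eps A. Proof. by []. Qed.

Let v_trace i (s t : R -> R) : measurable_fun setT s ->
  (forall x, - M <= s x <= g) ->
  has_trace eps Om (u i) (Du i) s t -> t = e1_field (a \o s) i ->
  has_trace eps Om (v i) (Dv i) s (fun=> 0).
Proof.
move=> ms sM ut tE; have [C1A _ _] := shear_C1 da ca'.
have := has_trace_add_scale (c i) mOm C1A A_periodic A_sq A_partial_sq
  (A_trace_sq ms sM) ut.
congr has_trace; apply/funext => r; rewrite tE /e1_field /c /A /=.
by case: ifP => _; rewrite ?mulN1r ?subrr// oppr0 mul0r addr0.
Qed.

Let Du_sq i j : square_integrable (lebesgue2 R) Om (Du i j).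
Proof. by have [[_ ? _] _ _] := stokes_top us i. Qed.

Let Dv_sq i j : square_integrable (lebesgue2 R) Om (Dv i j).
Proof. by apply: square_integrableD => //; exact: square_integrableZ. Qed.

(** The density of the Dirichlet form of [u] and [u - a(x_2) e_1]. *)
Let energy (x : R * R) := \sum_(i < 2) \sum_(j < 2) Du i j x * Dv i j x.

Let energy_integrable : (lebesgue2 R).-integrable Om (EFin \o energy).
Proof.
have int i j : (lebesgue2 R).-integrable Om
    (EFin \o (fun x => Du i j x * Dv i j x)).
  exact: square_integrable_mul.
have := integrableD mOm (integrableD mOm (int ord0 ord0) (int ord0 ord_max))
  (integrableD mOm (int ord_max ord0) (int ord_max ord_max)).
by apply: eq_integrable => // x _; rewrite /= /energy !sum_ord2 !EFinD.
Qed.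

(** The test field is divergence free almost everywhere, because [u] is and
    because a shear flow is, so the weak formulation loses its pressure term. *)
Let energy0 : \int[lebesgue2 R]_(x in Om) energy x = 0.
Proof.
have vtop i : has_trace eps Om (v i) (Dv i) (fun=> g) (fun=> 0).
  apply: v_trace (stokes_top us i) _ => //; last by rewrite topE.
  by move=> _; rewrite lexx ltW.
have vbot i : has_trace eps Om (v i) (Dv i) h (fun=> 0).
  apply: v_trace (stokes_bot us i) _ => //; last by rewrite botE.
  by move=> x; rewrite h_ge (le_trans (h_le0 x))// ltW.
rewrite -(stokes_momentum us vtop vbot); congr fine.
have [C1A p0 p1] := shear_C1 da ca'.
have mE : measurable_fun Om energy.
  by apply/measurable_EFinP; exact: measurable_int energy_integrable.
apply: ae_eq_integral => //.
- exact/measurable_EFinP.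
- apply/measurable_EFinP; apply: measurable_funB => //.
  apply: measurable_funM; first by case: (stokes_pressure us).
  rewrite (_ : (fun _ => _) = (fun x => Dv ord0 ord0 x + Dv ord_max ord_max x)).
    by apply: measurable_funD;
      [case: (Dv_sq ord0 ord0)|case: (Dv_sq ord_max ord_max)].
  by apply/funext => x; rewrite sum_ord2.
have := stokes_div us.
apply: (@filterS _ _ (ae_filter_ringOfSetsType (lebesgue2 R))) => x divu Omx.
have div0 : \sum_(i < 2) Dv i i x = 0.
  have := divu Omx; rewrite !sum_ord2 /Dv p0 p1 /c /= => divux.
  by rewrite -[RHS]divux oppr0 mul0r mulr0 !addr0.
by rewrite /= div0 mulr0 subr0.
Qed.

(** With [d = Du ord0 ord_max x] and [b = a' x.2], the density is a sum of
    squares plus [d * (d - b) >= (d^2 - b^2) / 2 >= (d^2 - K^2) / 2], and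
    [d^2 >= 2 * K * `|d| - K^2]. *)
Let energy_ge x : Om x -> K * `|Du ord0 ord_max x| <= energy x + K ^+ 2.
Proof.
move=> Omx; have [C1A p0 p1] := shear_C1 da ca'.
have aK := a'K (Om_height Omx); have K0 := K_gt0.
rewrite /energy !sum_ord2 /Dv p0 p1 /c /= oppr0 !mul0r mulr0 !addr0 mulN1r.
move: (Du ord0 ord0 x) (Du ord0 ord_max x) (Du ord_max ord0 x) => d1 d2 d3.
move: (Du ord_max ord_max x) (a' x.2) aK => d4 b bK.
have := sqr_ge0 d1; have := sqr_ge0 d3; have := sqr_ge0 d4.
have := sqr_ge0 (`|d2| - K); have := sqr_ge0 (d2 - b).
have : b ^+ 2 <= K ^+ 2.
  by rewrite -[b ^+ 2]real_normK ?num_real// lerXn2r ?nnegrE// ltW.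
have : `|d2| ^+ 2 = d2 ^+ 2 by rewrite real_normK ?num_real.
by rewrite !expr2; lra.
Qed.

(** Integrating [energy_ge] over the cell and using [energy0] bounds the
    integral of [`|d u_1 / d x_2|] by [K] times the area of the cell, which is
    at most [eps * (M + g)]. *)
Lemma shear_flux_bound (t : R -> R) :
  has_trace eps Om (u ord0) (Du ord0) (fun=> 0) t ->
  `|\int[lebesgue_measure]_(x in `]0, eps[) t x - eps * a g| <=
  K * (eps * (M + g)).
Proof.
move=> t0; set D := Du ord0 ord_max.
pose Q : set plane := `]0, eps[ `*` `]0, g[.
have mQ : measurable Q by exact: measurableX.
have sub : Q `<=` Om.
  move=> x [/=]; rewrite !in_itv /= => x1 /andP[x2 x3]; split=> //.
  by rewrite x3 (le_lt_trans (h_le0 _) x2).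
have diff := trace_difference eps_gt0 g_gt0 mOm sub t0 (stokes_top us ord0).
have topI : \int[lebesgue_measure]_(x in `]0, eps[) top ord0 x = eps * a g.
  have len : fine (@lebesgue_measure R `]0, eps[%classic) = eps.
    by rewrite lebesgue_measure_itv /= lte_fin eps_gt0 -EFinB subr0.
  rewrite topE /e1_field eqxx Rintegral_cst// mulrC; congr (_ * _).
  exact: len.
have iD : (lebesgue2 R).-integrable Om (EFin \o D).
  by refine (square_integrable_integrable mOm Om_fin (Du_sq _ _)).
have iN : (lebesgue2 R).-integrable Om (EFin \o (fun x => `|D x|)).
  exact: integrable_norm iD.
have iK : (lebesgue2 R).-integrable Om (EFin \o cst (K ^+ 2)).
  apply: square_integrable_integrable => //.
  exact: (@square_integrable_bounded _ _ _ _ _ mOm _ `|K ^+ 2|).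
rewrite distrC -topI -diff.
have QOm : \int[lebesgue2 R]_(x in Q) `|D x| <=
    \int[lebesgue2 R]_(x in Om) `|D x|.
  rewrite fine_le//.
  - by apply: integrable_fin_num => //; exact: integrableS iN.
  - exact: integrable_fin_num.
  - apply: (ge0_subset_integral _ mQ mOm _ _ sub) => [|x _].
      exact: measurable_int iN.
    by rewrite lee_fin.
apply: le_trans (le_normr_Rintegral mQ (integrableS mOm mQ sub iD)) _.
apply: le_trans QOm _.
have : \int[lebesgue2 R]_(x in Om) (K * `|D x|) <=
       \int[lebesgue2 R]_(x in Om) (energy x + K ^+ 2).
  apply: le_Rintegral => //.
  - have := integrableZl mOm K iN; apply: eq_integrable => // x _.
  - by have := integrableD mOm energy_integrable iK; apply: eq_integrable.
rewrite RintegralD// energy0 add0r Rintegral_cst// RintegralZl// expr2 -mulrA.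
rewrite ler_pM2l// => /le_trans; apply; rewrite ler_pM2l//.
rewrite -lee_fin fineK//.
by rewrite ge0_fin_numE.
Qed.

End StokesFlux.

(** * The fluxes of the two flows over a rough wall *)

Section RoughFluxes.
Variable R : realType.

(** Uniform in the sign of [s], so that [s = 0] is no special case when the
    square of the positive part is differentiated. *)
Lemma pos_part_sqr_taylor (s h : R) :
  `|Num.max (s + h) 0 ^+ 2 - Num.max s 0 ^+ 2 - 2 * Num.max s 0 * h| <= h ^+ 2.
Proof.
have h2 := sqr_ge0 h; rewrite ler_norml.
by case: (leP s 0) => s0; case: (leP (s + h) 0) => sh0; apply/andP; split; nra.
Qed.

Lemma is_derive_pos_part_sqr (s : R) :
  is_derive s 1 (fun r : R => Num.max r 0 ^+ 2) (2 * Num.max s 0).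
Proof.
pose q (h : R) := h^-1 *:
  (((fun r : R => Num.max r 0 ^+ 2) \o shift s) (h *: (1 : R))
   - Num.max s 0 ^+ 2).
suff cq : q h @[h --> 0^'] --> 2 * Num.max s 0.
  by apply: DeriveDef; [exact: cvgP cq|exact: cvg_lim cq].
apply/cvgrPdist_le => e e0; near=> h.
have h0 : h != 0 by near: h; exact: nbhs_dnbhs_neq.
have he : `|h| <= e.
  by near: h; apply: dnbhs0_le.
apply: le_trans he.
rewrite -(ler_pM2r (_ : 0 < `|h|)) ?normr_gt0// -normrM.
have -> : (2 * Num.max s 0 - q h) * h =
    - (Num.max (s + h) 0 ^+ 2 - Num.max s 0 ^+ 2 - 2 * Num.max s 0 * h).
  rewrite /q /= /shift /= (_ : h *: (1 : R) = h); last exact: mulr1.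
  by rewrite /GRing.scale /= [s + h]addrC; field.
by rewrite normrN -expr2 real_normK ?num_real//; exact: pos_part_sqr_taylor.
Unshelve. all: by end_near. Qed.

Variables (phi : R -> R).
Hypothesis phi_bounded : bounded_fun phi.
Hypothesis phi_lipschitz : exists k : R, k.-lipschitz phi.
Hypothesis phi_ge0 : forall x, 0 <= phi x.

Let phi_le x : phi x <= sup_norm phi.
Proof.
apply: le_trans (ler_norm _) _; apply: ub_le_sup; last by exists x.
have [L [_ phiL]] := phi_bounded; exists (L + 1) => _ [y _ <-].
by apply: phiL => //; rewrite ltrDl.
Qed.

Let rough_measurable eps : measurable_fun setT (rough phi eps).
Proof.
have cphi : continuous phi.
  have [k phik] := phi_lipschitz.
  move=> x; apply/cvgrPdist_le => e e0; near=> y.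
  have := phik (x, y) ltac:(by []); rewrite /= => /le_trans; apply.
  have k1 : 0 < `|k| + 1 by rewrite ltr_wpDl.
  apply: (@le_trans _ _ ((`|k| + 1) * `|x - y|)).
    by rewrite ler_wpM2r// ler_wpDr// ler_norm.
  rewrite -ler_pdivlMl//; near: y.
  by apply: cvgr_dist_le => //; rewrite mulr_gt0// invr_gt0.
rewrite /rough; apply: measurable_funB; last exact: measurable_cst.
apply: measurable_funM; first exact: measurable_cst.
apply: (measurableT_comp (f := phi)); first exact: continuous_measurable_fun.
apply: measurable_funM; [exact: measurable_id|exact: measurable_cst].
Unshelve. all: by end_near. Qed.

Let sup_norm_ge0 : 0 <= sup_norm phi.
Proof. exact: le_trans (phi_ge0 0) (phi_le 0). Qed.

Let rough_ge eps x : 0 < eps -> - (eps * sup_norm phi) <= rough phi eps x.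
Proof. by move=> e0; rewrite /rough lerDr mulr_ge0// ltW. Qed.

Let rough_le0 eps x : 0 < eps -> rough phi eps x <= 0.
Proof. by move=> e0; rewrite /rough -mulrBr pmulr_rle0// subr_le0. Qed.

(** The boundary data on the wall extend to the cell as a shear profile that
    vanishes at the top, with slope at most [2 * g]; the area of the cell is at
    most [2 * eps * g]. *)
Lemma B2_bound (eps g b : R) : 0 < eps -> 0 < g -> eps * sup_norm phi <= g ->
  is_B2 phi eps g b -> `|b| <= 4 * eps * g ^+ 2.
Proof.
move=> e0 g0; set M := eps * sup_norm phi => Mg [u [Du [p [t [us ut ->]]]]].
have M0 : 0 <= M by rewrite mulr_ge0// ltW.
pose a : R -> R := fun s => - (s + M) * (g - s).
pose a' : R -> R := fun s => 2 * s + M - g.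
have da (s : R) : is_derive s 1 a (a' s).
  apply: is_derive_eq (is_deriveM
    (is_deriveN (is_deriveD (is_derive_id s 1) (is_derive_cst M s 1)))
    (is_deriveB (is_derive_cst g s 1) (is_derive_id s 1))) _.
  change (- (s + M) * (0 - 1) + (g - s) * - (1 + 0) = 2 * s + M - g); ring.
have ca' : continuous a'.
  move=> s; apply: cvgB; last exact: cvg_cst.
  apply: cvgD; last exact: cvg_cst.
  by apply: cvgM; [exact: cvg_cst|exact: cvg_id].
have aK s : - M <= s <= g -> `|a' s| <= 2 * g.
  by move=> /andP[s1 s2]; rewrite /a' ler_norml; apply/andP; split; lra.
have topE : (fun _ _ => 0) = e1_field (fun=> a g) :> ('I_2 -> R -> R).
  apply/funext => i; apply/funext => x.
  by rewrite /e1_field /a subrr mulr0; case: ifP.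
have g20 : 0 < 2 * g by lra.
have := shear_flux_bound e0 M0 g0 g20 (rough_measurable eps)
  (fun x => rough_ge x e0) (fun x => rough_le0 x e0) da ca' aK topE erefl us ut.
rewrite {1}/a subrr mulr0 mulr0 subr0 => /le_trans; apply.
have : 2 * g * (eps * (M + g)) <= 2 * g * (eps * (g + g)).
  by rewrite !ler_wpM2l//; lra.
lra.
Qed.

(** A quadratic profile is used rather than the piecewise linear one because it
    is C^1 across [x_2 = 0]; its slope is at most [2 / g]. *)
Lemma B3_bound (eps g b : R) : 0 < eps -> 0 < g -> eps * sup_norm phi <= g ->
  is_B3 phi eps g b -> `|b| <= 5 * eps.
Proof.
move=> e0 g0; set M := eps * sup_norm phi => Mg [u [Du [p [t [us ut ->]]]]].
have M0 : 0 <= M by rewrite mulr_ge0// ltW.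
pose a : R -> R := fun s => (g ^+ 2)^-1 *: (Num.max s 0 ^+ 2).
pose a' : R -> R := fun s => (g ^+ 2)^-1 * (2 * Num.max s 0).
have da (s : R) : is_derive s 1 a (a' s).
  exact: (is_deriveZ _ (is_derive_pos_part_sqr s)).
have ca' : continuous a'.
  move=> s; apply: cvgM; first exact: cvg_cst.
  apply: cvgM; first exact: cvg_cst.
  by apply: (@continuous_max _ _ id (cst 0)); [exact: cvg_id|exact: cvg_cst].
have aK s : - M <= s <= g -> `|a' s| <= 2 / g.
  move=> /andP[s1 s2]; have m0 : 0 <= Num.max s 0 by rewrite le_max lexx orbT.
  have mg : Num.max s 0 <= g by rewrite ge_max s2 ltW.
  rewrite /a' ger0_norm; last by rewrite !mulr_ge0// invr_ge0 exprn_ge0// ltW.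
  rewrite (_ : 2 / g = (g ^+ 2)^-1 * (2 * g)); last by field; rewrite gt_eqF.
  by rewrite ler_wpM2l ?invr_ge0 ?sqr_ge0//; lra.
have a1 : a g = 1.
  by rewrite /a max_l ?ltW// [LHS]mulVf// expf_neq0// gt_eqF.
have topE : e1_field (fun=> 1) = e1_field (fun=> a g) by rewrite a1.
have botE : (fun _ _ => 0) = e1_field (a \o rough phi eps) :> ('I_2 -> R -> R).
  apply/funext => i; apply/funext => x; rewrite /e1_field /a /=.
  case: ifP => // _.
  by rewrite max_r ?rough_le0// expr0n [RHS]mulr0.
have g20 : 0 < 2 / g by rewrite divr_gt0.
have := shear_flux_bound e0 M0 g0 g20 (rough_measurable eps)
  (fun x => rough_ge x e0) (fun x => rough_le0 x e0) da ca' aK topE botE us ut.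
rewrite a1 mulr1; have : 2 / g * (eps * (M + g)) <= 4 * eps.
  rewrite mulrAC ler_pdivrMr// -[leRHS]mulrA.
  have : eps * (M + g) <= eps * (g + g) by rewrite ler_wpM2l//; lra.
  lra.
by rewrite !ler_norml => h1 /andP[h2 h3]; apply/andP; split; lra.
Qed.

End RoughFluxes.

(** * The macro-micro iteration *)

Section Iteration.
Variable R : realType.

Lemma T2_0 (g1 g2 : R) : g1 < 1 -> T2 g1 g2 0 = (g2 - g1) * (1 - g2).
Proof. by move=> g11; rewrite /T2; field; lra. Qed.

Lemma T2_subE (g1 g2 a b : R) : g1 < 1 -> 0 <= a -> 0 <= b ->
  T2 g1 g2 a - T2 g1 g2 b =
  (1 - g2) * ((1 - g1) / (1 - g1 + a)) * ((1 - g1) / (1 - g1 + b)) * (a - b).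
Proof. by move=> g11 a0 b0; rewrite /T2; field; lra. Qed.

Lemma T2_ge_T2_0 (g1 g2 a : R) : g1 < 1 -> g2 < 1 -> 0 <= a ->
  T2 g1 g2 0 <= T2 g1 g2 a.
Proof.
move=> g11 g21 a0; rewrite -subr_ge0 T2_subE//.
by do ?[apply: mulr_ge0 | rewrite invr_ge0]; lra.
Qed.

Lemma T2_nonexpansive (g1 g2 a b : R) : 0 < g1 < 1 -> 0 < g2 < 1 ->
  0 <= a -> 0 <= b -> `|T2 g1 g2 a - T2 g1 g2 b| <= `|a - b|.
Proof.
move=> g1b g2b a0 b0; rewrite T2_subE//; last lra.
have frac c : 0 <= c -> 0 <= (1 - g1) / (1 - g1 + c) <= 1.
  move=> c0; apply/andP; split; first by apply: divr_ge0; lra.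
  by rewrite ler_pdivrMr; [rewrite mul1r; lra | lra].
have := frac _ a0; have := frac _ b0; move: (_ / _) (_ / _) => x y y01 x01.
have xy0 : 0 <= (1 - g2) * x by rewrite mulr_ge0; lra.
rewrite normrM ler_piMl// ger0_norm; last by rewrite mulr_ge0//; lra.
by rewrite !mulr_ile1//; lra.
Qed.

Lemma T1_subE (eps M g1 g2 B2 B3 U V : R) :
  T1_dom eps M g1 g2 B2 B3 U -> T1_dom eps M g1 g2 B2 B3 V ->
  T1 eps M g1 g2 B2 B3 U - T1 eps M g1 g2 B2 B3 V =
  (C_2 g1 g2 B3 * C_3 eps M g1 g2 B2 - C_1 eps M g1 g2 B2 * (1 - B3)) *
  (U - V) / ((C_3 eps M g1 g2 B2 + (1 - B3) * U) *
             (C_3 eps M g1 g2 B2 + (1 - B3) * V)).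
Proof.
rewrite /T1_dom /T1; move: (C_1 _ _ _ _ _) (C_2 _ _ _) (C_3 _ _ _ _ _).
by move=> c1 c2 c3 DU DV; field; rewrite DU DV.
Qed.

Section Contraction.
Variables eps M g1 g2 B2 B3 : R.

(** What the asymptotic hypotheses give for small [eps]. The condition on
    [eps * g2] keeps [C_2] and [T1] positive; the one on [eps] makes the
    contraction factor at most [1 / 2], see [t_contract]. *)
Record small_regime : Prop := SmallRegime {
  sr_eps_gt0 : 0 < eps;
  sr_eps_le : eps <= 640^-1;
  sr_M_ge0 : 0 <= M;
  sr_M_le : M <= g2;
  sr_g1_gt0 : 0 < g1;
  sr_g1_le : g1 <= g2 / 4;
  sr_g2_le : g2 <= 1 / 4;
  sr_eps_g2_le : eps * g2 <= g1 / 20;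
  sr_B2_le : `|B2| <= 4 * eps * g2 ^+ 2;
  sr_B3_le : `|B3| <= 5 * eps }.

Hypothesis sr : small_regime.

Let U0 := T2 g1 g2 0.
Let t1 := T1 eps M g1 g2 B2 B3.
Let t := T eps M g1 g2 B2 B3.
Let den (U : R) : R := C_3 eps M g1 g2 B2 + (1 - B3) * U.

Let U0_ge : g2 / 2 <= U0.
Proof.
case: sr => *; rewrite /U0 T2_0; last lra.
have : 3 / 4 * g2 * (3 / 4) <= (g2 - g1) * (1 - g2) by apply: ler_pM; lra.
lra.
Qed.

Let normC3 : `|C_3 eps M g1 g2 B2| <= 8 * eps * g2 ^+ 2.
Proof.
case: sr => *; rewrite /C_3 (le_trans (ler_normB _ _))//.
have -> : 8 * eps * g2 ^+ 2 = eps * g2 * (4 * g2) + 4 * eps * g2 ^+ 2 by ring.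
rewrite lerD// normrM [`|eps * g2|]ger0_norm; last by rewrite mulr_ge0; lra.
rewrite ler_wpM2l//; first by rewrite mulr_ge0; lra.
by rewrite ler_norml; apply/andP; split; lra.
Qed.

Let normC1 : `|C_1 eps M g1 g2 B2| <= 6 * eps * g2 ^+ 2.
Proof.
case: sr => *; rewrite /C_1 -mulrDl normrM [`|g2 - g1|]ger0_norm; last lra.
have h1 : `|eps * g2 * (g1 + M) + B2| <= 6 * eps * g2 ^+ 2.
  rewrite (le_trans (ler_normD _ _))//.
  have -> : 6 * eps * g2 ^+ 2 = eps * g2 * (2 * g2) + 4 * eps * g2 ^+ 2 by ring.
  rewrite lerD// normrM [`|eps * g2|]ger0_norm; last by rewrite mulr_ge0; lra.
  rewrite ler_wpM2l//; first by rewrite mulr_ge0; lra.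
  by rewrite ler_norml; apply/andP; split; lra.
by apply: le_trans h1; rewrite ler_piMr//; lra.
Qed.

Let C2_bounds : g1 / 2 <= C_2 g1 g2 B3 <= 1.
Proof.
case: sr => e0 ? ? ? ? ? ? ? _ /[!ler_norml] /andP[B3a B3b].
have ha : - (5 * eps) * (g2 - g1) <= B3 * (g2 - g1) by rewrite ler_wpM2r//; lra.
have hb : B3 * (g2 - g1) <= 5 * eps * (g2 - g1) by rewrite ler_wpM2r//; lra.
have : 0 < eps * g1 by rewrite mulr_gt0; lra.
by rewrite /C_2 => ?; apply/andP; split; lra.
Qed.

Let den_ge U : U0 <= U -> g2 / 4 <= den U.
Proof.
move=> hU; have U_ge := le_trans U0_ge hU.
case: sr => e0 e1 ? ? ? ? ? ? _ /[!ler_norml] /andP[B3a B3b].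
have := normC3; rewrite ler_norml => /andP[C3a _].
have hB : (3 / 4) * U <= (1 - B3) * U by rewrite ler_wpM2r//; lra.
have hC : eps * g2 ^+ 2 <= 640^-1 * (g2 * (1 / 4)).
  by apply: ler_pM; rewrite ?sqr_ge0 1?expr2 ?ler_wpM2l//; lra.
by rewrite /den; lra.
Qed.

Let T1_domU U : U0 <= U -> T1_dom eps M g1 g2 B2 B3 U.
Proof.
move=> /den_ge hd; case: sr => *; rewrite /T1_dom gt_eqF//.
by rewrite /den in hd; lra.
Qed.

Let t1_gt0 U : U0 <= U -> 0 < t1 U.
Proof.
move=> hU; have U_ge := le_trans U0_ge hU.
have /andP[C2a _] := C2_bounds; have := den_ge hU.
case: sr => e0 e1 ? ? g10 ? ? eg /[!ler_norml] /andP[B2a B2b] _ dU.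
apply: divr_gt0; last by rewrite -/(den U); lra.
have C2U : g1 / 2 * (g2 / 2) <= C_2 g1 g2 B3 * U by apply: ler_pM; lra.
have C1a : - (4 * eps * g2 ^+ 2) * (g2 - g1) <= C_1 eps M g1 g2 B2.
  rewrite /C_1 -mulrDl ler_wpM2r//; first lra.
  have : 0 <= eps * g2 * (g1 + M) by rewrite !mulr_ge0; lra.
  lra.
(* [C_2 * U >= g1 * g2 / 4] absorbs the negative part of [C_1] *)
have : eps * g2 * (g2 * (g2 - g1)) <= g1 / 20 * (g2 * 1).
  have g2g1 : g2 * (g2 - g1) <= g2 * 1 by rewrite ler_wpM2l//; lra.
  by apply: ler_pM => //; apply: mulr_ge0; lra.
have : 0 < g1 * g2 by rewrite mulr_gt0; lra.
by rewrite expr2 in C1a; lra.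
Qed.

Let t_ge U : U0 <= U -> U0 <= t U.
Proof.
by move=> hU; case: sr => *; apply: T2_ge_T2_0; [lra|lra|exact/ltW/t1_gt0].
Qed.

(** The determinant of [T1] is at most [20 * eps * g2 ^+ 2] and each denominator
    is at least [g2 / 4], so [T1] is Lipschitz with constant [320 * eps]; [T2]
    does not increase distances. *)
Let t_contract U V : U0 <= U -> U0 <= V -> `|t U - t V| <= 1 / 2 * `|U - V|.
Proof.
move=> hU hV; have [t1U t1V] := (ltW (t1_gt0 hU), ltW (t1_gt0 hV)).
have denU := den_ge hU; have denV := den_ge hV.
have /andP[C2a C2b] := C2_bounds.
case: sr => e0 e1 ? ? g10 ? ? eg _ B3b.
have /andP[B3l B3r] : - (5 * eps) <= B3 <= 5 * eps by rewrite -ler_norml.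
apply: (@le_trans _ _ `|t1 U - t1 V|).
  by apply: T2_nonexpansive => //; lra.
rewrite /t1 T1_subE; [|exact: T1_domU|exact: T1_domU].
rewrite mulrAC normrM ler_wpM2r// normf_div -/(den U) -/(den V).
have dd : g2 / 4 * (g2 / 4) <= den U * den V by rewrite ler_pM//; lra.
have dd0 : 0 < g2 / 4 * (g2 / 4) by rewrite mulr_gt0//; lra.
have D0 : 0 < den U * den V by lra.
rewrite ler_pdivrMr ?normr_gt0 ?gt_eqF// (gtr0_norm D0)//.
have eg2 : eps * g2 ^+ 2 <= 640^-1 * g2 ^+ 2 by rewrite ler_wpM2r ?sqr_ge0//.
apply: le_trans (_ : _ <= 20 * eps * g2 ^+ 2) _; last first.
  rewrite expr2 in eg2 *; lra.
rewrite (le_trans (ler_normB _ _))// !normrM.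
have -> : 20 * eps * g2 ^+ 2 = 1 * (8 * eps * g2 ^+ 2) + 6 * eps * g2 ^+ 2 * 2.
  by ring.
rewrite lerD// ler_pM//; first by rewrite ger0_norm//; lra.
by rewrite ler_norml; apply/andP; split; lra.
Qed.

(** The half line [U0 <= U] is closed and stable under [T], so the limit stays
    in it and inherits the strict inequalities that hold on all of it. *)
Lemma U_seq_cvg_positive :
  let U := U_seq eps M g1 g2 B2 B3 in
  [/\ T2_dom g1 0,
      forall n, T1_dom eps M g1 g2 B2 B3 (U n) /\
                T2_dom g1 (T1 eps M g1 g2 B2 B3 (U n)) &
      exists Ustar : R,
        [/\ U n @[n --> \oo] --> Ustar, T1_dom eps M g1 g2 B2 B3 Ustar &
            0 < T1 eps M g1 g2 B2 B3 Ustar]].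
Proof.
have g11 : g1 < 1 by case: sr => *; lra.
pose I : set R := [set U | U0 <= U].
have tI : set_fun I I t by move=> U; exact: t_ge.
pose F : {fun I >-> I} := mkfun_fun tI.
have I0 : I U0 by rewrite /I /=.
have ctr : contraction (1 / 2)%:nng F.
  split=> /=; first lra.
  by move=> [U V] [/= hU hV]; exact: t_contract.
have cvU := contraction_cvg ctr I0.
have IU n : I (iter n t U0) by elim: n => //= n; exact: t_ge.
have cI : closed I by exact: closed_ge.
have Ilim : I (limn (fun n => iter n F U0)).
  by apply: closed_cvg cvU => //; apply: nearW => n; exact: IU.
split; first by rewrite /T2_dom lt_eqF//; lra.
  move=> n; split; first exact/T1_domU/IU.
  have := t1_gt0 (IU n); rewrite /T2_dom /U_seq -/t -/U0 -/(t1 _) => h.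
  by rewrite lt_eqF//; lra.
exists (limn (fun n => iter n F U0)); split => //.
- exact: T1_domU.
- exact: t1_gt0.
Qed.

End Contraction.
End Iteration.

(** * Convergence for small roughness *)

Lemma at_right0_exists (R : realType) (P : R -> Prop) :
  (\forall e \near 0^'+, P e) ->
  exists2 e0, 0 < e0 & forall e, 0 < e < e0 -> P e.
Proof.
case=> e0 /= e00 eP; exists e0 => // e /andP[e_gt0 e_lt].
by apply: eP => //=; rewrite sub0r normrN gtr0_norm.
Qed.

Lemma at_right0_le (R : realType) (f : R -> R) (c : R) : 0 < c ->
  f e @[e --> 0^'+] --> 0 -> \forall e \near 0^'+, f e <= c.
Proof.
move=> c0 f0; have fc : \forall e \near 0^'+, `|f e| <= c.
  exact: cvgr0_norm_le.
near=> e.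
by apply: le_trans (ler_norm _) _; near: e.
Unshelve. all: by end_near. Qed.

Theorem theorem3p11 (R : realType) (phi : R -> R) (e1 : R)
    (gamma1 gamma2 B2 B3 : R -> R)
    (phi_bounded : bounded_fun phi)
    (phi_lipschitz : exists k : R, k.-lipschitz phi)
    (phi_periodic : periodic phi 1)
    (phi_ge0 : forall x, 0 <= phi x)
    (H_gt0 : 0 < sup_norm phi)
    (phi_int : forall N : int, phi N%:~R = sup_norm phi)
    (e1_gt0 : 0 < e1)
    (gamma_bounds : forall eps, 0 < eps < e1 ->
       0 < gamma1 eps /\ gamma1 eps < gamma2 eps /\ gamma2 eps < 1)
    (gamma1_to0 : monotone_to_0 e1 gamma1)
    (gamma2_to0 : monotone_to_0 e1 gamma2)
    (ratio_to0 : monotone_to_0 e1 (fun eps => gamma1 eps / gamma2 eps))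
    (eps_ratio_to0 : monotone_to_0 e1 (fun eps => eps / gamma2 eps))
    (lim_to0 : eps * gamma2 eps / gamma1 eps @[eps --> 0^'+] --> 0)
    (B2_def : forall eps, 0 < eps < e1 -> is_B2 phi eps (gamma2 eps) (B2 eps))
    (B3_def : forall eps, 0 < eps < e1 -> is_B3 phi eps (gamma2 eps) (B3 eps)) :
  exists2 eps0 : R, 0 < eps0 & forall eps, 0 < eps < eps0 ->
    let M := eps * sup_norm phi in
    let g1 := gamma1 eps in
    let g2 := gamma2 eps in
    let T1eps := T1 eps M g1 g2 (B2 eps) (B3 eps) in
    let T1dom := T1_dom eps M g1 g2 (B2 eps) (B3 eps) in
    let U := U_seq eps M g1 g2 (B2 eps) (B3 eps) in
    [/\ T2_dom g1 0,
        forall n, T1dom (U n) /\ T2_dom g1 (T1eps (U n)) &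
        exists Ustar : R,
          [/\ U n @[n --> \oo] --> Ustar, T1dom Ustar & 0 < T1eps Ustar]].
Proof.
have [_ lim2] := gamma2_to0.
have [_ limr] := ratio_to0.
have [_ lime] := eps_ratio_to0.
have c20 : 0 < 20^-1 :> R by rewrite invr_gt0.
have c4 : 0 < 1 / 4 :> R by lra.
have cH : 0 < (sup_norm phi)^-1 by rewrite invr_gt0.
have n1 := at_right0_le c4 lim2.
have n2 := at_right0_le c4 limr.
have n3 := at_right0_le cH lime.
have n4 := at_right0_le c20 lim_to0.
have c640 : 0 < Num.min e1 640^-1 by rewrite lt_min e1_gt0 invr_gt0 ltr0n.
have [e0 e00 He] := at_right0_exists (filterI (filterI n1 n2) (filterI n3 n4)).
exists (Num.min e0 (Num.min e1 640^-1)); first by rewrite lt_min e00.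
move=> eps /andP[eps_gt0]; rewrite !lt_min => /and3P[eps_e0 eps_e1 eps640].
have eps_in : 0 < eps < e1 by rewrite eps_gt0.
have eps_in0 : 0 < eps < e0 by rewrite eps_gt0.
have [[h1 h2] [h3 h4]] := He _ eps_in0.
have [g1_gt0 [g12 g2_lt1]] := gamma_bounds _ eps_in.
have g2_gt0 := lt_trans g1_gt0 g12.
have Mg2 : eps * sup_norm phi <= gamma2 eps.
  by rewrite -ler_pdivlMr// mulrC -ler_pdivrMr.
apply: U_seq_cvg_positive; split => //.
- exact: ltW.
- by rewrite mulr_ge0// ltW.
- by move: h2; rewrite ler_pdivrMr//; lra.
- by move: h4; rewrite ler_pdivrMr//; lra.
- exact: B2_bound (B2_def _ eps_in).
- exact: B3_bound (B3_def _ eps_in).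
Qed.
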